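(* If $\mathbf{L}\in\mathbb{SDM}$, then the class of p-ideals of $\mathbf{L}$ coincides with the class $\mathcal{I}_{\mathbb{SDM}}(\mathbf{L})$ of $\mathbb{SDM}$-ideals of $\mathbf{L}$ (in the sense of Ursini, with respect to $0$).
   Context: A bounded involution lattice is an algebra $(L,\wedge,\vee,{}^{\prime},0,1)$ such that $(L,\wedge,\vee,0,1)$ is a bounded lattice, $a^{\prime\prime}=a$, and $a\leq b$ implies $b^{\prime}\leq a^{\prime}$. It is a pseudo-Kleene algebra if $a\wedge a^{\prime}\leq b\vee b^{\prime}$ for all $a,b$. A BZ-lattice is an algebra $\mathbf{L}=(L,\wedge,\vee,{}^{\prime},{}^{\sim},0,1)$ whose reduct without ${}^{\sim}$ is a pseudo-Kleene algebra and such that for all $a,b\in L$: $a\wedge a^{\sim}=0$; $a\leq a^{\sim\sim}$; $a\leq b$ implies $b^{\sim}\leq a^{\sim}$; $a^{\sim\prime}=a^{\sim\sim}$. Write $\Diamond x=x^{\sim\sim}$ and $\square x=x^{\prime\sim}$. A PBZ$^{\ast}$-lattice is a BZ-lattice satisfying $(a\wedge a^{\prime})^{\sim}\leq a^{\sim}\vee\square a$ for all $a$, and which is paraorthomodular: $a\leq b$ and $a^{\prime}\wedge b=0$ imply $a=b$. PBZ$^{\ast}$-lattices form a variety $\mathbb{PBZL}^{\ast}$. $\mathbb{SDM}$ is the subvariety of $\mathbb{PBZL}^{\ast}$ axiomatised relative to it by $(x\wedge y)^{\sim}\approx x^{\sim}\vee y^{\sim}$. A p-ideal of a PBZ$^{\ast}$-lattice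 $\mathbf{L}$ is a lattice ideal $I$ of $\mathbf{L}$ (nonempty, downward closed, closed under binary joins) such that if $a\in I$, then $\Diamond b\wedge(b^{\sim}\vee\Diamond a)\in I$ for all $b\in L$. For a class $\mathbb{K}$ of algebras of the same type with constant $0$, a term $p(\overrightarrow{x},\overrightarrow{y})$ is a $\mathbb{K}$-ideal term in $\overrightarrow{x}$ if $\mathbb{K}\models p(0,\ldots,0,\overrightarrow{y})\approx 0$. A nonempty subset $J$ of the universe $A$ of $\mathbf{A}\in\mathbb{K}$ is a $\mathbb{K}$-ideal of $\mathbf{A}$ (w.r.t. $0$) if for every $\mathbb{K}$-ideal term $p(\overrightarrow{x},\overrightarrow{y})$ in $\overrightarrow{x}$, $p^{\mathbf{A}}(\overrightarrow{a},\overrightarrow{b})\in J$ whenever all entries of $\overrightarrow{a}$ are in $J$ and all entries of $\overrightarrow{b}$ are in $A$. $\mathcal{I}_{\mathbb{K}}(\mathbf{A})$ is the set of all $\mathbb{K}$-ideals of $\mathbf{A}$. *)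

(* Defs.v *)
From HB Require Import structures.
From mathcomp Require Import all_boot all_order.
From mathcomp Require Import boolp classical_sets.

Set Implicit Arguments.
Unset Strict Implicit.
Unset Printing Implicit Defensive.

Local Open Scope classical_set_scope.
Local Open Scope order_scope.

(* The Kleene complement x' is written [kneg x] and the Brouwer complement x~
   is written [bneg x]; 0 and 1 are [\bot] and [\top], which may coincide. *)

HB.mixin Record isInvolutionLattice d T of Order.TBLattice d T := {
  kneg : T -> T;
  knegK : forall x : T, kneg (kneg x) = x;
  le_kneg : forall x y : T, x <= y -> kneg y <= kneg x
}.

#[short(type="involutionLatticeType")]
HB.structure Definition InvolutionLattice d :=
  { T of Order.TBLattice d T & isInvolutionLattice d T }.

HB.mixin Record isPseudoKleene d T of InvolutionLattice d T := {
  kleene_le : forall x y : T, x `&` kneg x <= y `|` kneg y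
}.

#[short(type="pseudoKleeneType")]
HB.structure Definition PseudoKleene d :=
  { T of InvolutionLattice d T & isPseudoKleene d T }.

HB.mixin Record isBZLattice d T of PseudoKleene d T := {
  bneg : T -> T;
  meet_bneg : forall x : T, x `&` bneg x = \bot;
  le_bnegbneg : forall x : T, x <= bneg (bneg x);
  le_bneg : forall x y : T, x <= y -> bneg y <= bneg x;
  kneg_bneg : forall x : T, kneg (bneg x) = bneg (bneg x)
}.

#[short(type="bzLatticeType")]
HB.structure Definition BZLattice d :=
  { T of PseudoKleene d T & isBZLattice d T }.

Definition diamond d (L : bzLatticeType d) (x : L) : L := bneg (bneg x).
Definition box d (L : bzLatticeType d) (x : L) : L := bneg (kneg x).

Definition paraorthomodular d (L : involutionLatticeType d) : Prop :=
  forall x y : L, x <= y -> kneg x `&` y = \bot -> x = y.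

Definition bzClass := forall d : Order.disp_t, bzLatticeType d -> Prop.

Definition PBZLstar : bzClass := fun d L =>
  (forall x : L, bneg (x `&` kneg x) <= bneg x `|` box x)
  /\ paraorthomodular L.

Definition SDM : bzClass := fun d L =>
  PBZLstar L /\ forall x y : L, bneg (x `&` y) = bneg x `|` bneg y.

Definition lattice_ideal d (L : latticeType d) (I : set L) : Prop :=
  [/\ I !=set0,
      forall x y : L, x <= y -> I y -> I x
    & forall x y : L, I x -> I y -> I (x `|` y)].

Definition p_ideal d (L : bzLatticeType d) (I : set L) : Prop :=
  lattice_ideal I /\
  forall x y : L, I x -> I (diamond y `&` (bneg y `|` diamond x)).

Inductive bzterm (V : Type) : Type :=
| TVar of V
| TBot
| TTop
| TMeet of bzterm V & bzterm V
| TJoin of bzterm V & bzterm V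
| TKneg of bzterm V
| TBneg of bzterm V.

Fixpoint eval d (L : bzLatticeType d) (V : Type) (e : V -> L) (t : bzterm V)
    : L :=
  match t with
  | TVar v => e v
  | TBot => \bot
  | TTop => \top
  | TMeet t1 t2 => eval e t1 `&` eval e t2
  | TJoin t1 t2 => eval e t1 `|` eval e t2
  | TKneg t1 => kneg (eval e t1)
  | TBneg t1 => bneg (eval e t1)
  end.

(* A term p(x_0, ..., x_(m-1), y_0, ..., y_(n-1)) has variables in
   'I_m + 'I_n, the left summand being the block of the x_i. *)
Definition eval2 d (L : bzLatticeType d) m n (p : bzterm ('I_m + 'I_n))
    (a : 'I_m -> L) (b : 'I_n -> L) : L :=
  eval (fun v => match v with inl i => a i | inr j => b j end) p.

Definition ideal_term (K : bzClass) m n (p : bzterm ('I_m + 'I_n)) : Prop :=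
  forall d (A : bzLatticeType d), K d A ->
  forall b : 'I_n -> A, eval2 p (fun=> \bot) b = \bot.

Definition ursini_ideal (K : bzClass) d (A : bzLatticeType d) (J : set A)
    : Prop :=
  J !=set0 /\
  forall m n (p : bzterm ('I_m + 'I_n)), ideal_term K p ->
  forall (a : 'I_m -> A) (b : 'I_n -> A),
    (forall i, J (a i)) -> J (eval2 p a b).

Definition ursini_ideals (K : bzClass) d (A : bzLatticeType d) : set (set A) :=
  [set J | ursini_ideal K J].

Arguments ursini_ideals K [d] A.

(* Main.v *)
(* In SDM the Brouwer complement turns meets into joins, so x~ and x'~ depend on
   x through dual lattice homomorphisms.  For a p-ideal I, let a == b mean that
   a v i = b v i for some i in I; orthomodularity of the sharp elements makes
   this relation compatible with the Brouwer complement.  Hence relating x and y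
   when x~ == y~ and x'~ == y'~ is a congruence, and its 0-class is I.  So if a
   is in I and p is an ideal term, then p(a, b) is congruent to p(0, b) = 0, i.e.
   it is in I. *)
Require Import Defs.
From mathcomp Require Import all_boot all_order.
From mathcomp Require Import boolp classical_sets.

Import Order.Theory.

Local Open Scope classical_set_scope.
Local Open Scope order_scope.

Section BZLattice.
Context {d : Order.disp_t} {L : bzLatticeType d}.
Implicit Types x y : L.

Lemma bneg1 : bneg (\top : L) = \bot.
Proof. by rewrite -(meet_bneg \top) meet1x. Qed.

Lemma bneg0 : bneg (\bot : L) = \top.
Proof.
by apply/le_anti; rewrite lex1 /= -bneg1; apply: le_bnegbneg.
Qed.

Lemma bneg3 x : bneg (bneg (bneg x)) = bneg x.
Proof. by apply/le_anti; rewrite le_bnegbneg andbT; apply/le_bneg/le_bnegbneg. Qed.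

Lemma bnegU x y : bneg (x `|` y) = bneg x `&` bneg y.
Proof.
apply/le_anti; rewrite lexI !le_bneg ?leUl ?leUr //=.
apply: le_trans (le_bnegbneg _) _; apply: le_bneg; rewrite leUx.
by rewrite (le_trans (le_bnegbneg x)) ?(le_trans (le_bnegbneg y)) ?le_bneg
  ?leIl ?leIr.
Qed.

Lemma knegU x y : kneg (x `|` y) = kneg x `&` kneg y.
Proof.
apply/le_anti; rewrite lexI !le_kneg ?leUl ?leUr //=.
rewrite -[leLHS]knegK; apply: le_kneg; rewrite leUx.
by rewrite -{1}[x]knegK -{2}[y]knegK !le_kneg ?leIl ?leIr.
Qed.

Lemma knegI x y : kneg (x `&` y) = kneg x `|` kneg y.
Proof. by rewrite -[RHS]knegK knegU !knegK. Qed.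

Lemma kneg0 : kneg (\bot : L) = \top.
Proof. by apply/le_anti; rewrite lex1 -[X in X <= _]knegK le_kneg ?le0x. Qed.

Lemma box_le x : box x <= x.
Proof.
rewrite -[leRHS]knegK -[leLHS]knegK; apply: le_kneg.
by rewrite /box kneg_bneg; apply: le_bnegbneg.
Qed.

End BZLattice.

(** Each closure condition is an instance of an ideal term, namely $x\wedge y$, $x_0\vee x_1$ and
    $\Diamond y\wedge(y^{\sim}\vee\Diamond x)$. All three vanish at $x=0$ in every BZ-lattice, hence
    in every member of [K]. *)
Lemma ursini_ideal_p_ideal (K : bzClass) d (L : bzLatticeType d) (J : set L) :
  ursini_ideal K J -> p_ideal J.
Proof.
move=> [Jn0 Jterm].
split; first split => // x y.
- move=> xy Jy.
  have := Jterm 1 1 (TMeet (TVar (inl ord0)) (TVar (inr ord0))) _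
    (fun=> y) (fun=> x) (fun=> Jy).
  rewrite /eval2 /= (meet_r xy); apply=> d' A _ b.
  by rewrite /eval2 /= meet0x.
- move=> Jx Jy.
  have := Jterm 2 0 (TJoin (TVar (inl ord0)) (TVar (inl ord_max))) _
    (fun i => if i == ord0 then x else y) (fun=> x).
  rewrite /eval2 /=; apply=> [d' A _ b|i]; last by case: ifP.
  by rewrite /eval2 /= joinxx.
- move=> x y Jx; pose y0 : bzterm ('I_1 + 'I_1) := TVar (inr ord0).
  pose p := TMeet (TBneg (TBneg y0))
    (TJoin (TBneg y0) (TBneg (TBneg (TVar (inl ord0))))).
  have := Jterm 1 1 p _ (fun=> x) (fun=> y) (fun=> Jx).
  rewrite /eval2 /= /diamond; apply=> d' A _ b.
  by rewrite /eval2 /= bneg0 bneg1 joinx0 meetC meet_bneg.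
Qed.

Definition join_eqmod {d} {L : latticeType d} (I : set L) (x y : L) : Prop :=
  exists2 i, I i & x `|` i = y `|` i.

Definition sdm_eqmod {d} {L : bzLatticeType d} (I : set L) (x y : L) : Prop :=
  join_eqmod I (bneg x) (bneg y) /\ join_eqmod I (box x) (box y).

Section PIdeal.
Context {d : Order.disp_t} {L : bzLatticeType d}.
Hypothesis hL : SDM L.
Context {I : set L}.
Hypothesis pI : p_ideal I.
Implicit Types x y u v : L.

Local Notation "x ~~ y" := (join_eqmod I x y) (at level 70).
Local Notation "x ~= y" := (sdm_eqmod I x y) (at level 70).

Lemma SDM_bnegI x y : bneg (x `&` y) = bneg x `|` bneg y.
Proof. by case: hL. Qed.

(** Paraorthomodularity applies because, with $z=x\vee y^{\sim}$, the meet that has to vanish is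
    $z^{\sim}\wedge z^{\sim\sim}$. *)
Lemma bneg_orthomodular {x y} : x <= y ->
  bneg y `|` (bneg x `&` bneg (bneg y)) = bneg x.
Proof.
move=> xy; have [[_ paraOM] _] := hL; apply: paraOM.
  by rewrite leUx leIl le_bneg.
by rewrite knegU kneg_bneg -bnegU kneg_bneg -meetA [_ `&` bneg x]meetC meetA
  [_ `&` bneg x]meetC -bnegU meet_bneg.
Qed.

(** This is the p-ideal condition at $x^{\sim}$, where the SDM law gives $x^{\sim\sim}\vee
    i^{\sim\sim}=(x\vee i)^{\sim\sim}$. *)
Lemma p_ideal_sasaki x {i} : I i -> I (bneg x `&` bneg (bneg (x `|` i))).
Proof.
case: pI => _ Isas Ii; have := Isas i (bneg x) Ii.
by rewrite /diamond bneg3 bnegU SDM_bnegI.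
Qed.

Lemma join_eqmod_refl x : x ~~ x.
Proof. by have [[[i Ii] _ _] _] := pI; exists i. Qed.

Lemma join_eqmodU {x y u v} : x ~~ y -> u ~~ v -> x `|` u ~~ y `|` v.
Proof.
have [[_ _ IU] _] := pI => -[i Ii xy] [j Ij uv].
exists (i `|` j); first exact: IU.
by rewrite joinACA xy uv joinACA.
Qed.

(* With c = (x v i)~ = (y v i)~, orthomodularity splits x~ and y~ into c and
   Sasaki projections of i, and the latter are in I. *)
Lemma join_eqmod_bneg {x y} : x ~~ y -> bneg x ~~ bneg y.
Proof.
have [[_ _ IU] _] := pI => -[i Ii xy].
have Ix := p_ideal_sasaki x Ii; have Iy := p_ideal_sasaki y Ii.
exists ((bneg x `&` bneg (bneg (x `|` i))) `|` (bneg y `&` bneg (bneg (y `|` i)))).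
  exact: IU.
rewrite -{1}(bneg_orthomodular (leUl x i)) -{2}(bneg_orthomodular (leUl y i)) xy.
by rewrite -!joinA; congr (_ `|` _); rewrite joinA joinxx joinCA joinxx.
Qed.

(** Meets of Brouwer complements reduce to joins, since $x^{\sim}\wedge u^{\sim}=(x^{\sim\sim}\vee
    u^{\sim\sim})^{\sim}$. *)
Lemma join_eqmod_bnegI {x y u v} : bneg x ~~ bneg y -> bneg u ~~ bneg v ->
  bneg x `&` bneg u ~~ bneg y `&` bneg v.
Proof.
move=> xy uv.
have := join_eqmod_bneg (join_eqmodU (join_eqmod_bneg xy) (join_eqmod_bneg uv)).
by rewrite !bnegU !bneg3.
Qed.

(** The Kleene complement swaps the two components of the relation. *)
Lemma sdm_eqmod_kneg {x y} : x ~= y -> kneg x ~= kneg y.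
Proof. by case=> ? ?; split => //; rewrite /box !knegK. Qed.

(** As $\square(x^{\sim})=x^{\sim\sim\sim}=x^{\sim}$, the first component of the hypothesis yields
    both components of the conclusion. *)
Lemma sdm_eqmod_bneg {x y} : x ~= y -> bneg x ~= bneg y.
Proof.
by case=> xy _; split; rewrite /box ?kneg_bneg ?bneg3 //; apply: join_eqmod_bneg.
Qed.

(** The SDM law turns the first component into a join; $\square$ preserves meets, so the second is a
    meet of Brouwer complements. *)
Lemma sdm_eqmodI {x y u v} : x ~= y -> u ~= v -> x `&` u ~= y `&` v.
Proof.
move=> [nxy bxy] [nuv buv]; split; first by rewrite !SDM_bnegI; apply: join_eqmodU.
by rewrite /box !knegI !bnegU; apply: join_eqmod_bnegI.
Qed.

Lemma sdm_eqmodU {x y u v} : x ~= y -> u ~= v -> x `|` u ~= y `|` v.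
Proof.
move=> xy uv; rewrite -[x `|` u]knegK -[y `|` v]knegK !knegU.
by apply/sdm_eqmod_kneg/sdm_eqmodI; apply: sdm_eqmod_kneg.
Qed.

Lemma sdm_eqmod_eval {V : Type} {e f : V -> L} (t : bzterm V) :
  (forall k, e k ~= f k) -> eval e t ~= eval f t.
Proof.
move=> ef; elim: t => //= [||t1 IH1 t2 IH2|t1 IH1 t2 IH2|t|t].
- by split; apply: join_eqmod_refl.
- by split; apply: join_eqmod_refl.
- exact: sdm_eqmodI.
- exact: sdm_eqmodU.
- exact: sdm_eqmod_kneg.
- exact: sdm_eqmod_bneg.
Qed.

Lemma sdm_eqmod0 x : x ~= \bot <-> I x.
Proof.
have [[_ Idown _] _] := pI; split=> [[nx _]|Ix].
  (* Complementing once more gives $x^{\sim\sim}\vee i=0\vee i=i$, so $x\leq x^{\sim\sim}\leq i$. *)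
  have [i Ii] := join_eqmod_bneg nx.
  rewrite bneg0 bneg1 join0x => xi; apply: Idown Ii.
  by rewrite (le_trans (le_bnegbneg x)) // -xi leUl.
have eqm0 y : I y -> y ~~ \bot by exists y; rewrite ?joinxx ?join0x.
split; first exact/join_eqmod_bneg/eqm0.
rewrite {2}/box kneg0 bneg1; apply: eqm0; exact: Idown (box_le x) Ix.
Qed.

Lemma p_ideal_ursini_ideal : ursini_ideal SDM I.
Proof.
split=> [|m n p idp a b Ia]; first by have [[]] := pI.
apply/sdm_eqmod0; rewrite -(idp _ _ hL b).
by apply: sdm_eqmod_eval => -[i|j]; [exact/sdm_eqmod0|split; apply: join_eqmod_refl].
Qed.

End PIdeal.

Theorem theorem48 (d : Order.disp_t) (L : bzLatticeType d) (hL : SDM L) :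
  [set I : set L | p_ideal I] = ursini_ideals SDM L.
Proof.
apply/seteqP; split=> I; first exact: p_ideal_ursini_ideal.
exact: ursini_ideal_p_ideal.
Qed.
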